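(* Let $E$ be a directed graph that satisfies condition (L), let $K$ be a field, and let $B$ be a $K$-algebra. If $\phi:D(X)\rtimes_\alpha\mathbb{F}\to B$ is a $K$-algebra homomorphism such that $\phi(1_v\delta_0)\ne 0$ for each $v\in E^0$, then $\phi$ is injective.
   Context: **Graph.** $E=(E^0,E^1,r,s)$ is a directed graph with vertex set $E^0$, edge set $E^1$, and range and source maps $r,s:E^1\to E^0$ (no finiteness assumption). A sink is a vertex $v$ with $s^{-1}(v)=\emptyset$. $W$ is the set of finite paths of length at least $1$: words $\xi_1\cdots\xi_n$, $n\ge 1$, $\xi_i\in E^1$, $r(\xi_i)=s(\xi_{i+1})$. $W^\infty$ is the set of infinite paths $\xi_1\xi_2\xi_3\cdots$, $r(\xi_i)=s(\xi_{i+1})$ for all $i$. Extend $s(\xi)=s(\xi_1)$ for $\xi\in W\cup W^\infty$, $r(\xi_1\cdots\xi_n)=r(\xi_n)$, and $r(v)=s(v)=v$ for $v\in E^0$. $|a|$ is the length of $a\in W$. **Condition (L).** Every closed path has an exit: for every $b=b_1\cdots b_n\in W$ with $s(b)=r(b)$ there exist $i$ and an edge $t\in E^1$ with $s(t)=s(b_i)$ and $t\ne b_i$. **Sets.** $\mathbb{F}$ is the free group generated by $E^1$, with neutral element denoted $0$; $W$ is viewed as a subset of $\mathbb{F}$. Let $X=\{\xi\in W: r(\xi)\text{ is a sink}\}\cup\{v\in E^0: v\text{ is a sink}\}\cup W^\infty$. Define $X_0=X$; for $b\in W$, $X_{b^{-1}}=\{\xi\in X: s(\xi)=r(b)\}$;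 for $a\in W$, $X_a=\{\xi\in X:\xi_1\cdots\xi_{|a|}=a\}$; for $a,b\in W$ with $r(a)=r(b)$ and $ab^{-1}$ reduced (i.e. $a_{|a|}\ne b_{|b|}$), $X_{ab^{-1}}=X_a$; and $X_c=\emptyset$ for all other $c\in\mathbb{F}$. For $v\in E^0$, $X_v=\{\xi\in X:s(\xi)=v\}$. **Partial action on $X$.** $\theta_0=\mathrm{id}_X$; for $b\in W$, $\theta_b:X_{b^{-1}}\to X_b$, $\theta_b(\xi)=b\xi$ (with $b\,r(b)=b$ when $r(b)$ is a sink), and $\theta_{b^{-1}}=\theta_b^{-1}$; for $a,b\in W$ with $r(a)=r(b)$, $a_{|a|}\neq b_{|b|}$, $\theta_{ab^{-1}}:X_{ba^{-1}}\to X_{ab^{-1}}$, $\theta_{ab^{-1}}(\xi)=a\xi_{|b|+1}\xi_{|b|+2}\cdots$; otherwise $\theta_c$ is the empty map. **Algebras.** $F(X)$ is the $K$-algebra of functions $X\to K$ with pointwise operations; $F(X_c)$ is the ideal of functions vanishing outside $X_c$; $\alpha_c:F(X_{c^{-1}})\to F(X_c)$ is $\alpha_c(f)=f\circ\theta_{c^{-1}}$ (extended by zero outside $X_c$). $1_c$ and $1_v$ are the characteristic functions of $X_c$ ($c\in\mathbb{F}$) and $X_v$ ($v\in E^0$). Let $D(X)=D_0$ be the $K$-linear span of $\{1_p:p\in\mathbb{F}\setminus\{0\}\}\cup\{1_v:v\in E^0\}$, and for $p\in\mathbb{F}\setminus\{0\}$ let $D_p=1_pD_0$, the $K$-linear span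 of $\{1_p1_q:q\in\mathbb{F}\}$. Each $\alpha_p$ restricts to an isomorphism $D_{p^{-1}}\to D_p$, giving a partial action of $\mathbb{F}$ on $D_0$. **Partial skew group ring.** $D(X)\rtimes_\alpha\mathbb{F}$ is the $K$-algebra of finite formal sums $\sum_{p\in\mathbb{F}}a_p\delta_p$ with $a_p\in D_p$, with componentwise linear structure and product determined by $(a_p\delta_p)(b_q\delta_q)=\alpha_p(\alpha_{p^{-1}}(a_p)b_q)\delta_{pq}$. Algebras and homomorphisms are not required to be unital. *)

(* Defs.v *)
From HB Require Import structures.
From mathcomp Require Import all_boot all_algebra.
From mathcomp Require Import boolp classical_sets functions cardinality fsbigop.

Set Implicit Arguments.
Unset Strict Implicit.
Unset Printing Implicit Defensive.

Import GRing.Theory.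

Local Open Scope classical_set_scope.
Local Open Scope ring_scope.

Section FreeGroup.
Variable T : choiceType.

(* (x, true) stands for the generator x, (x, false) for its inverse. *)
Local Notation letter := (T * bool)%type.

Definition inv_letter (l : letter) : letter := (l.1, ~~ l.2).

Definition reduced (w : seq letter) : bool :=
  sorted (fun l m => m != inv_letter l) w.

Record freegroup := FreeGroup { fg_word :> seq letter; _ : reduced fg_word }.
HB.instance Definition _ := [isSub for fg_word].
HB.instance Definition _ := [Choice of freegroup by <:].

Definition red_cons (l : letter) (w : seq letter) : seq letter :=
  if w is m :: w' then if m == inv_letter l then w' else l :: w else [:: l].

Lemma inv_letterK : involutive inv_letter.
Proof. by case=> x b; rewrite /inv_letter /= negbK. Qed.

Lemma reduced_behead l w : reduced (l :: w) -> reduced w.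
Proof. by case: w => //= m w /andP[]. Qed.

Lemma red_cons_reduced l w : reduced w -> reduced (red_cons l w).
Proof.
case: w => //= m w rw; case: eqP => [_|/eqP nm].
  exact: (@reduced_behead m).
by rewrite /reduced /= nm.
Qed.

Lemma red_consK l w : reduced w -> red_cons l (red_cons (inv_letter l) w) = w.
Proof.
case: w => [|m w] rw /=; first by rewrite eqxx.
rewrite inv_letterK; case: eqP rw => [->|_] rw; last by rewrite /= eqxx.
by move: rw; rewrite /reduced; case: w => [|k w] //= /andP[/negPf ->].
Qed.

Lemma foldr_red_cons_reduced u v : reduced v -> reduced (foldr red_cons v u).
Proof. by move=> rv; elim: u => //= l u; apply: red_cons_reduced. Qed.

Definition fg_mul (u v : freegroup) : freegroup :=
  @FreeGroup (foldr red_cons (val v) (val u))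
    (foldr_red_cons_reduced (val u) (valP v)).

Definition fg_one : freegroup := @FreeGroup [::] isT.

Lemma reduced_inv w : reduced w -> reduced (map inv_letter (rev w)).
Proof.
rewrite /reduced => rw; rewrite sorted_map rev_sorted.
apply: sub_sorted rw => l m /=; apply: contra => /eqP ->.
by rewrite inv_letterK eqxx.
Qed.

Definition fg_inv (u : freegroup) : freegroup :=
  @FreeGroup (map inv_letter (rev (val u))) (reduced_inv (valP u)).

Lemma foldr_red_cons_red l u w : reduced w ->
  foldr red_cons w (red_cons l u) = red_cons l (foldr red_cons w u).
Proof.
move=> rw; case: u => //= m u; case: eqP => [->|//].
by rewrite red_consK ?foldr_red_cons_reduced.
Qed.

Lemma fg_mulA : associative fg_mul.
Proof.
move=> u v w; apply: val_inj => /=; elim: (val u) => //= l u' ->.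
by rewrite foldr_red_cons_red // (valP w).
Qed.

Lemma fg_mul1 : left_id fg_one fg_mul.
Proof. by move=> u; apply: val_inj. Qed.

Lemma foldr_red_cons_nil w : reduced w -> foldr red_cons [::] w = w.
Proof.
elim: w => //= l w IHw rw; rewrite IHw ?(reduced_behead rw) //.
by case: w rw {IHw} => //= m w; rewrite /reduced /= => /andP[/negPf ->].
Qed.

Lemma fg_mulr1 : right_id fg_one fg_mul.
Proof. by move=> u; apply: val_inj; rewrite /= foldr_red_cons_nil ?(valP u). Qed.

Lemma fg_mulV : right_inverse fg_one fg_inv fg_mul.
Proof.
case=> u ru; apply: val_inj => /=.
elim: u ru => //= l u IHu ru; have ru' := reduced_behead ru.
rewrite rev_cons map_rcons.
have H s m : reduced (rcons s m) ->
    rcons s m = foldr red_cons [:: m] s.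
  move=> r; rewrite -[LHS](foldr_red_cons_nil r) -cats1 foldr_cat //.
rewrite H; last by rewrite -map_rcons -rev_cons reduced_inv.
set s := map _ _.
have A (a b w : seq letter) : reduced w ->
    foldr red_cons (foldr red_cons w b) a =
    foldr red_cons w (foldr red_cons b a).
  by move=> rw; elim: a => //= m a ->; rewrite foldr_red_cons_red.
rewrite A // /s IHu //=.
by rewrite eqxx.
Qed.

Lemma fg_invK : involutive fg_inv.
Proof.
case=> u ru; apply: val_inj => /=; rewrite !map_rev revK -map_comp.
by rewrite -[RHS]map_id; apply: eq_map => l; rewrite /= inv_letterK.
Qed.

Lemma fg_mulVl : left_inverse fg_one fg_inv fg_mul.
Proof. by move=> u; rewrite -{2}(fg_invK u) fg_mulV. Qed.

HB.instance Definition _ := isGroup.Build freegroup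
  fg_mulA fg_mul1 fg_mulr1 fg_mulVl fg_mulV.

Definition fg_gen (x : T) : freegroup := @FreeGroup [:: (x, true)] isT.

End FreeGroup.

Record digraph := Digraph {
  vertex : Type;
  edge : Type;
  src : edge -> vertex;
  rng : edge -> vertex
}.
Arguments src {d} _.
Arguments rng {d} _.

HB.instance Definition _ (E : digraph) := gen_eqMixin (vertex E).
HB.instance Definition _ (E : digraph) := gen_choiceMixin (vertex E).
HB.instance Definition _ (E : digraph) := gen_eqMixin (edge E).
HB.instance Definition _ (E : digraph) := gen_choiceMixin (edge E).

Section Graph.
Variable E : digraph.
Implicit Types (v : vertex E) (e : edge E) (w : seq (edge E)).

Definition is_sink v : Prop := forall e, src e <> v.

Fixpoint walk v w : bool :=
  if w is e :: w' then (src e == v) && walk (rng e) w' else true.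

Definition walk_end v w : vertex E := last v (map rng w).

(* The set W: the length-0 paths (vertices) are excluded. *)
Record fpath := FPath {
  fhead : edge E;
  ftail : seq (edge E);
  _ : walk (rng fhead) ftail
}.

Definition fseq (a : fpath) : seq (edge E) := fhead a :: ftail a.
Definition fsrc (a : fpath) : vertex E := src (fhead a).
Definition frng (a : fpath) : vertex E := walk_end (rng (fhead a)) (ftail a).
Definition flast (a : fpath) : edge E := last (fhead a) (ftail a).
Definition flen (a : fpath) : nat := size (fseq a).

Definition fnth (a : fpath) (i : nat) : edge E := nth (fhead a) (fseq a) i.

Definition condition_L : Prop :=
  forall b : fpath, fsrc b = frng b ->
  exists2 i : nat, (i < flen b)%N &
    exists t : edge E, src t = src (fnth b i) /\ t <> fnth b i.

(* Fin v w is the finite path w starting at v, so that Fin v [::] is the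
   vertex v; with this encoding b r(b) = b needs no separate convention. *)
Inductive rawpath : Type :=
| Fin of vertex E & seq (edge E)
| Inf of nat -> edge E.

Definition raw_src (p : rawpath) : vertex E :=
  match p with Fin v _ => v | Inf x => src (x 0%N) end.

Definition raw_take (n : nat) (p : rawpath) : seq (edge E) :=
  match p with Fin _ w => take n w | Inf x => mkseq x n end.

Definition raw_cons e (p : rawpath) : rawpath :=
  match p with
  | Fin _ w => Fin (src e) (e :: w)
  | Inf x => Inf (fun i => if i is j.+1 then x j else e)
  end.

Definition raw_cat w (p : rawpath) : rawpath := foldr raw_cons p w.

Definition is_boundary (p : rawpath) : Prop :=
  match p with
  | Fin v w => walk v w /\ is_sink (walk_end v w)
  | Inf x => forall i, rng (x i) = src (x i.+1)
  end.

Record bpath := BPath { braw :> rawpath; _ : is_boundary braw }.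

Lemma braw_inj : injective braw.
Proof.
by case=> p hp [q hq] /= epq; case: q / epq hq => hq; rewrite (Prop_irrelevance hp hq).
Qed.

Lemma brawP (xi : bpath) : is_boundary xi. Proof. by case: xi. Qed.

Definition bsrc (xi : bpath) : vertex E := raw_src xi.

Definition begins (a : fpath) (xi : bpath) : Prop :=
  raw_take (flen a) xi = fseq a.

Lemma raw_cat_src v w (p : rawpath) :
  walk v w -> walk_end v w = raw_src p -> raw_src (raw_cat w p) = v.
Proof.
case: w => [|e w] /=; first by move=> _ <-.
by move=> /andP[/eqP <- _] _; case: (raw_cat w p).
Qed.

Lemma raw_cat_boundary v w (p : rawpath) : is_boundary p ->
  walk v w -> walk_end v w = raw_src p -> is_boundary (raw_cat w p).
Proof.
move=> bp; elim: w v => //= e w IHw v /andP[/eqP ev hw] hend.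
have := IHw _ hw hend; have := raw_cat_src hw hend.
case: (raw_cat w p) => [u t|x] /=.
  by move=> -> [wt st]; rewrite eqxx wt.
by move=> ex bx [|i].
Qed.

Lemma fwalk (b : fpath) : walk (fsrc b) (fseq b).
Proof. by case: b => e w hw; rewrite /fseq /fsrc /= eqxx hw. Qed.

Definition bcat (b : fpath) (xi : bpath) (h : frng b = bsrc xi) : bpath :=
  BPath (@raw_cat_boundary (fsrc b) (fseq b) xi (brawP xi) (fwalk b) h).

Local Notation FG := (freegroup (edge E)).

Definition word w : FG := foldr (fun e g => (fg_gen e * g)%g) 1%g w.

Definition fword (a : fpath) : FG := word (fseq a).

(* The four clauses are mutually exclusive, and the decompositions of c in the
   last three are unique (irred_uniq). *)
Definition X (c : FG) : set bpath :=
  [set xi | [\/ c = 1%g,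
    exists b : fpath, c = ((fword b)^-1)%g /\ bsrc xi = frng b,
    exists a : fpath, c = fword a /\ begins a xi |
    exists a b : fpath, [/\ frng a = frng b, flast a <> flast b,
      c = (fword a * (fword b)^-1)%g & begins a xi]]].

Definition Xv v : set bpath := [set xi | bsrc xi = v].

(* theta c xi eta means that xi lies in X_{c^-1} and theta_c(xi) = eta; see
   theta_dom, theta_fun and theta_inv. *)
Inductive theta : FG -> bpath -> bpath -> Prop :=
| theta_one xi : theta 1%g xi xi
| theta_cat b xi (h : frng b = bsrc xi) :
    theta (fword b) xi (bcat h)
| theta_uncat b xi (h : frng b = bsrc xi) :
    theta ((fword b)^-1)%g (bcat h) xi
| theta_subst a b xi (ha : frng a = bsrc xi) (hb : frng b = bsrc xi) :
    flast a <> flast b ->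
    theta (fword a * (fword b)^-1)%g (bcat hb) (bcat ha).

(* p = w z, where w may be empty. *)
Definition ext w (z p : rawpath) : Prop :=
  [/\ p = raw_cat w z, walk (raw_src p) w & walk_end (raw_src p) w = raw_src z].

Definition shift_eq (c : FG) (p q : rawpath) : Prop :=
  exists u w (z : bpath), [/\ ext u z p, ext w z q & c = (word w * (word u)^-1)%g].

Lemma word_cat u w : word (u ++ w) = (word u * word w)%g.
Proof. by elim: u => [|e u IHu] /=; rewrite ?mul1g // IHu mulgA. Qed.

Lemma word_val w : fg_word (word w) = [seq (e, true) | e <- w].
Proof.
elim: w => //= e w IHw; rewrite IHw.
by case: w {IHw} => //= f w; rewrite xpair_eqE andbF.
Qed.

Lemma word_inj : injective word.
Proof.
move=> u w /(congr1 (@fg_word _)); rewrite !word_val.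
by apply: inj_map => e f [].
Qed.

Lemma walk_cat v u w : walk v (u ++ w) = walk v u && walk (walk_end v u) w.
Proof. by elim: u v => //= e u IHu v; rewrite IHu andbA. Qed.

Lemma walk_end_cat v u w : walk_end v (u ++ w) = walk_end (walk_end v u) w.
Proof. by rewrite /walk_end map_cat last_cat. Qed.

Lemma raw_cat_cat u w p : raw_cat (u ++ w) p = raw_cat u (raw_cat w p).
Proof. by rewrite /raw_cat foldr_cat. Qed.

Lemma ext_src v w (z : rawpath) : walk v w -> walk_end v w = raw_src z ->
  ext w z (raw_cat w z).
Proof. by move=> hw he; rewrite /ext (raw_cat_src hw he). Qed.

Lemma ext_comp u w z p q : ext u z p -> ext w p q -> ext (w ++ u) z q.
Proof.
move=> [-> hu eu] [-> hw ew]; split; first by rewrite raw_cat_cat.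
  by rewrite walk_cat hw ew.
by rewrite walk_end_cat ew.
Qed.

Lemma raw_cons_inj e f (p q : rawpath) : rng e = raw_src p -> rng f = raw_src q ->
  raw_cons e p = raw_cons f q -> e = f /\ p = q.
Proof.
case: p => [v w|x]; case: q => [v' w'|y] //= sp sq.
  by case=> _ ef ew; rewrite -sp -sq ef ew.
case=> exy; split; first exact: (congr1 (fun h => h 0%N) exy).
by congr Inf; apply/funext => i; exact: (congr1 (fun h => h i.+1) exy).
Qed.

Lemma ext_cons e w z p : ext (e :: w) z p ->
  exists2 q, p = raw_cons e q & ext w z q /\ rng e = raw_src q.
Proof.
case=> /= ep /andP[/eqP es hw] he.
have E1 := raw_cat_src hw he.
by exists (raw_cat w z) => //; rewrite E1; split=> //; split; rewrite ?E1.
Qed.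

Lemma ext_compare u w z z' p : ext u z p -> ext w z' p ->
  exists t, (w = u ++ t /\ ext t z' z) \/ (u = w ++ t /\ ext t z z').
Proof.
elim: u w p => [|e u IHu] w p.
  by case=> /= <- _ _ h; exists w; left.
case: w => [|f w] h1 h2.
  by exists (e :: u); right; split=> //; case: h2 => /= <- _ _.
have [q eq [h3 s3]] := ext_cons h1.
have [q' eq' [h4 s4]] := ext_cons h2.
have [|ef qq] := raw_cons_inj s3 s4; first by rewrite -eq.
subst f q'; have [t [[-> ?]|[-> ?]]] := IHu _ _ h3 h4; exists t; by [left|right].
Qed.

Lemma shift_eq_comp c d p q r : shift_eq c p q -> shift_eq d q r ->
  shift_eq (d * c)%g p r.
Proof.
case=> u [w [z [h1 h2 ->]]] [u' [w' [z' [h3 h4 ->]]]].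
have [t [[eu ht]|[ew ht]]] := ext_compare h2 h3.
  exists (u ++ t), w', z'; split=> //; first exact: ext_comp ht h1.
  by rewrite eu !word_cat !invgM -!mulgA mulKg.
exists u, (w' ++ t), z; split=> //; first exact: ext_comp ht h4.
by rewrite ew !word_cat -!mulgA mulKg.
Qed.

Lemma shift_eq_inv c p q : shift_eq c p q -> shift_eq c^-1%g q p.
Proof.
by case=> u [w [z [h1 h2 ->]]]; exists w, u, z; split=> //; rewrite invgM invgK.
Qed.

Lemma shift_eq_fun c p q r : shift_eq c p q -> shift_eq c p r -> q = r.
Proof.
case=> u [w [z [h1 h2 ->]]] [u' [w' [z' [h3 h4]]]].
have [t [[eu ht]|[eu ht]]] := ext_compare h1 h3; subst.
  rewrite word_cat invgM mulgA => /mulIg ew.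
  have {}ew : w' = w ++ t by apply: word_inj; rewrite word_cat ew mulgVK.
  by subst w'; case: (ext_comp ht h2) h4 => -> _ _ [-> _ _].
rewrite word_cat invgM mulgA => /mulIg ew.
have {}ew : w = w' ++ t by apply: word_inj; rewrite word_cat -ew mulgVK.
by subst w; case: (ext_comp ht h4) h2 => -> _ _ [-> _ _].
Qed.

Lemma ext_bcat b xi (h : frng b = bsrc xi) : ext (fseq b) xi (bcat h).
Proof. exact: ext_src (fwalk b) h. Qed.

Lemma ext_nil (p : rawpath) : ext [::] p p. Proof. by split. Qed.

Lemma theta_shift_eq c (xi eta : bpath) : theta c xi eta -> shift_eq c xi eta.
Proof.
case=> {c xi eta} [xi|b xi h|b xi h|a b xi ha hb _].
- by exists [::], [::], xi; split=> //; rewrite mulgV.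
- exists [::], (fseq b), xi; split=> //; first exact: ext_bcat.
  by rewrite invg1 mulg1.
- exists (fseq b), [::], xi; split=> //; first exact: ext_bcat.
  by rewrite mul1g.
- by exists (fseq b), (fseq a), xi; split=> //; apply: ext_bcat.
Qed.

Lemma ext_fpath e w z p : ext (e :: w) z p ->
  exists2 b : fpath, fseq b = e :: w & frng b = raw_src z.
Proof. by case=> /= _ /andP[_ hw] he; exists (FPath hw). Qed.

Lemma bcatE b (z p : bpath) (h : frng b = bsrc z) : ext (fseq b) z p -> bcat h = p.
Proof. by case=> ep _ _; apply: braw_inj; rewrite ep. Qed.

Lemma ext_rcons w e z p : ext (rcons w e) z p ->
  ext w (raw_cons e z) p /\ rng e = raw_src z.
Proof.
case=> ep; rewrite -cats1 walk_cat walk_end_cat /= andbT => /andP[hw /eqP es] he.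
split=> //; split=> //; last by rewrite -es; case: (z).
by rewrite ep -cats1 raw_cat_cat.
Qed.

Lemma shift_eq_theta c (xi eta : bpath) : shift_eq c xi eta -> theta c xi eta.
Proof.
case=> u [w [z [h1 h2 ->]]].
elim/last_ind: u w z h1 h2 => [|u e IHu] w z h1 h2.
  rewrite invg1 mulg1; case: w h2 => [|f w] h2.
    have -> : xi = eta.
      by apply: braw_inj; case: h1 h2 => -> _ _ [-> _ _].
    exact: theta_one.
  have [b eb hb] := ext_fpath h2.
  have h1' : braw z = braw xi by case: h1 => ->.
  move/braw_inj: h1' => h1'; subst z.
  have hx : bcat (xi:=xi) hb = eta by apply: bcatE; rewrite eb.
  rewrite -eb -hx.
  exact: theta_cat.
case: (lastP w) h2 => [|w' f] h2.
  have h2' : braw z = braw eta by case: h2 => ->.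
  move/braw_inj: h2' => h2'; subst z.
  rewrite mul1g.
  case eu : (rcons u e) h1 => [|g u']; first by case: (u) eu.
  move=> h1; have [b eb hb] := ext_fpath h1.
  have hx : bcat (xi:=eta) hb = xi by apply: bcatE; rewrite eb.
  rewrite -eb -hx.
  exact: theta_uncat.
have [ef|nef] := pselect (e = f).
  subst f; have [h1' s1] := ext_rcons h1; have [h2' _] := ext_rcons h2.
  have bz : is_boundary (raw_cons e z).
    apply: (@raw_cat_boundary (src e) [:: e] z (brawP z)) => //=.
    by rewrite eqxx.
  have := IHu w' (BPath bz) h1' h2'.
  by rewrite -!cats1 !word_cat invgM -mulgA mulVKg.
case eu : (rcons u e) h1 => [|g u']; first by case: (u) eu.
case ew : (rcons w' f) h2 => [|g' u'']; first by case: (w') ew.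
move=> h2 h1; have [a ea ha] := ext_fpath h2; have [b eb hb] := ext_fpath h1.
have hx : bcat hb = xi by apply: bcatE; rewrite eb.
have hy : bcat ha = eta by apply: bcatE; rewrite ea.
rewrite -eb -ea -hx -hy.
apply: theta_subst => efl; apply: nef.
have: last e (fseq b) = last e (fseq a) by rewrite /= -/(flast b) -/(flast a) efl.
by rewrite eb ea -eu -ew !last_rcons.
Qed.

Lemma thetaE c (xi eta : bpath) : theta c xi eta <-> shift_eq c xi eta.
Proof. by split; [exact: theta_shift_eq | exact: shift_eq_theta]. Qed.

Lemma theta_inv c xi eta : theta c xi eta -> theta c^-1%g eta xi.
Proof. by rewrite !thetaE; exact: shift_eq_inv. Qed.

Lemma theta_comp c d xi eta zeta : theta c xi eta -> theta d eta zeta ->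
  theta (d * c)%g xi zeta.
Proof. by rewrite !thetaE; exact: shift_eq_comp. Qed.

Lemma theta_fun c xi eta eta' : theta c xi eta -> theta c xi eta' -> eta = eta'.
Proof. by rewrite !thetaE => h h'; apply: braw_inj; exact: shift_eq_fun h h'. Qed.

Lemma raw_uncons (p : bpath) e w : raw_take (size w).+1 p = e :: w ->
  exists q : bpath,
    [/\ braw p = raw_cons e q, rng e = bsrc q & raw_take (size w) q = w].
Proof.
case: p => -[v [|f u]|x] //=.
  move=> [/andP[/eqP fv hu] hs] [ef hw]; subst f.
  by exists (@BPath (Fin (rng e) u) (conj hu hs)); rewrite /= fv.
move=> bx; rewrite /mkseq /= => -[<- ew].
exists (@BPath (Inf (fun i => x i.+1)) (fun i => bx i.+1)) => /=.
split; last by rewrite -[RHS]ew /mkseq (iotaDl 1 0) -map_comp.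
  by congr Inf; apply/funext; case.
exact: bx.
Qed.

Lemma raw_cons_src e p : raw_src (raw_cons e p) = src e.
Proof. by case: p. Qed.

Lemma raw_take_ext w (p : bpath) : raw_take (size w) p = w ->
  exists z : bpath, ext w z p.
Proof.
elim: w p => [|e w IHw] p; first by exists p; split.
move=> /raw_uncons[q [ep sq /IHw[z [eq hw he]]]]; exists z; split.
- by rewrite ep eq.
- by rewrite ep raw_cons_src /= eqxx sq.
- by rewrite ep raw_cons_src -he -[raw_src q]sq.
Qed.

Lemma ext_raw_take w z p : ext w z p -> raw_take (size w) p = w.
Proof.
case=> -> _ _; elim: w => [|e w IHw] /=.
  by case: z => //= v w; rewrite take0.
case: (raw_cat w z) IHw => [v u|x] /= IHw; first by rewrite IHw.
by rewrite -[in RHS]IHw /mkseq /= (iotaDl 1 0) -map_comp.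
Qed.

Lemma beginsP a xi :
  begins a xi <-> exists (z : bpath) (h : frng a = bsrc z), xi = bcat h.
Proof.
split=> [/raw_take_ext[z hz]|[z [h ->]]]; last exact: ext_raw_take (ext_bcat h).
have h : frng a = bsrc z by case: hz => _ /= /andP[].
by exists z, h; rewrite (bcatE h hz).
Qed.

Lemma theta_domV c xi eta : theta c xi eta -> X c^-1%g xi.
Proof.
case=> {c xi eta} [xi|b xi h|b xi h|a b xi ha hb nab].
- by apply: Or41; rewrite invg1.
- by apply: Or42; exists b.
- by apply: Or43; exists b; rewrite invgK; split=> //; apply/beginsP; exists xi, h.
- apply: Or44; exists b, a; split; last by apply/beginsP; exists xi, hb.
  + by rewrite hb ha.
  + by move=> e; apply: nab.
  + by rewrite invgM invgK.
Qed.

Lemma theta_dom c xi : X c xi <-> exists eta, theta c^-1%g xi eta.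
Proof.
split.
- case=> [->|[b [-> h]]|[a [-> /beginsP[z [h ->]]]]|].
  + by exists xi; rewrite invg1; exact: theta_one.
  + by rewrite invgK; exists (bcat (esym h)); exact: theta_cat.
  + by exists z; exact: theta_uncat.
  move=> [a [b [eab lab -> /beginsP[z [h ->]]]]].
  have h' : frng b = bsrc z by rewrite -eab.
  exists (bcat h'); rewrite invgM invgK; apply: theta_subst.
  by move=> e; apply: lab.
- by move=> [eta /theta_domV]; rewrite invgK.
Qed.

Definition irred u w : Prop :=
  forall e f u' w', u = rcons u' e -> w = rcons w' f -> e <> f.

Lemma irred_word u w : irred u w ->
  fg_word (word u * (word w)^-1)%g =
  [seq (e, true) | e <- u] ++ [seq (e, false) | e <- rev w].
Proof.
have -> : fg_word (word u * (word w)^-1)%g =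
    foldr (@red_cons _) [seq (e, false) | e <- rev w] [seq (e, true) | e <- u].
  rewrite -word_val -[LHS]/(foldr (@red_cons _) (fg_word (word w)^-1%g) (word u)).
  congr foldr; rewrite -[LHS]/([seq inv_letter l | l <- rev (fg_word (word w))]).
  by rewrite word_val -map_rev -map_comp.
elim: u => //= e u IHu irr; rewrite IHu; last first.
  by move=> f g u' w' eu; apply: (irr f g (e :: u') w'); rewrite eu.
case: u irr {IHu} => [|f u] irr /=; last by rewrite xpair_eqE andbF.
case/lastP: w irr => [|w f] irr //=; rewrite rev_rcons /= xpair_eqE andbT.
by case: eqP => // fe; case: (irr e f [::] w).
Qed.

Lemma irred_uniq u w u' w' : irred u w -> irred u' w' ->
  (word u * (word w)^-1 = word u' * (word w')^-1)%g -> u = u' /\ w = w'.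
Proof.
move=> i i' /(congr1 (@fg_word _)); rewrite !irred_word // => eL.
pose pos (L : seq (edge E * bool)) := [seq l.1 | l <- L & l.2].
pose neg (L : seq (edge E * bool)) := [seq l.1 | l <- L & ~~ l.2].
have posE s t : pos ([seq (e, true) | e <- s] ++ [seq (e, false) | e <- t]) = s.
  by rewrite /pos; elim: s => [|e s IHs] /=; [elim: t | rewrite IHs].
have negE s t : neg ([seq (e, true) | e <- s] ++ [seq (e, false) | e <- t]) = t.
  by rewrite /neg; elim: s => //=; elim: t => //= e t ->.
split; first by rewrite -(posE u (rev w)) eL posE.
by rewrite -[w]revK -(negE u (rev w)) eL negE revK.
Qed.

Lemma irred_nill w : irred [::] w. Proof. by move=> ? ? [] . Qed.

Lemma irred_nilr u : irred u [::]. Proof. by move=> ? ? ? []. Qed.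

Lemma irred_fpath a b : flast a <> flast b -> irred (fseq a) (fseq b).
Proof.
move=> nab e f u w; rewrite /fseq !lastI => /rcons_inj[_ <-] /rcons_inj[_ <-].
exact: nab.
Qed.

Lemma fseq_inj : injective fseq.
Proof.
by case=> e w h [f u h'] [ef ew]; subst; rewrite (bool_irrelevance h h').
Qed.

Lemma X_cases c xi : X c xi -> c <> 1%g ->
  (exists2 b : fpath, c = (word [::] * (word (fseq b))^-1)%g & bsrc xi = frng b)
  \/ exists (a : fpath) w, [/\ c = (word (fseq a) * (word w)^-1)%g,
       irred (fseq a) w, begins a xi &
       forall eta, begins a eta -> X c eta].
Proof.
case=> [->//|[b [-> h]]|[a [-> h]]|[a [b [eab nab -> h]]]] _.
- by left; exists b; rewrite // mul1g.
- right; exists a, [::]; split=> //; first by rewrite invg1 mulg1.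
    exact: irred_nilr.
  by move=> eta he; apply: Or43; exists a.
right; exists a, (fseq b); split=> //; first exact: irred_fpath.
by move=> eta he; apply: Or44; exists a, b.
Qed.

Lemma word_neq1 e w : word (e :: w) <> 1%g.
Proof. by move=> /(@word_inj (e :: w) [::]). Qed.

Lemma X_fword a xi : X (fword a) xi <-> begins a xi.
Proof.
split=> [|h]; last by apply: Or43; exists a.
have ea : fword a = (word (fseq a) * (word [::])^-1)%g by rewrite invg1 mulg1.
move=> /X_cases[|[b]|[b [w []]]]; first exact: word_neq1.
  by rewrite ea => /irred_uniq[]//; [exact: irred_nilr|exact: irred_nill].
rewrite ea => /irred_uniq eab irr; case: eab => //; first exact: irred_nilr.
by move=> /fseq_inj -> _.
Qed.

Lemma X_shape c : c <> 1%g ->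
  [\/ X c = set0, exists v, X c = Xv v | exists a, X c = X (fword a)].
Proof.
move=> c1; have [->|/set0P[xi hxi]] := eqVneq (X c) set0; first exact: Or31.
case: (X_cases hxi c1) => [[b cb hb]|[a [w [ca irr ha himp]]]].
  apply: Or32; exists (frng b); apply/seteqP; split=> eta; last first.
    by move=> h; apply: Or42; exists b; rewrite cb mul1g.
  move=> /X_cases/(_ c1)[[b']|[a [w []]]]; rewrite cb.
    by move=> /irred_uniq[]; [exact: irred_nill..|move=> _ /fseq_inj ->].
  move=> /irred_uniq eab irr; by case: eab => //; exact: irred_nill.
apply: Or33; exists a; apply/seteqP; split=> eta; last by move/X_fword/himp.
move=> /X_cases/(_ c1)[[b']|[a' [w' []]]]; rewrite ca.
  by move=> /irred_uniq[]//; exact: irred_nill.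
move=> /irred_uniq eab irr'; case: eab => // /fseq_inj <- _ h _.
exact/X_fword.
Qed.

Lemma ext_catl u t z p : ext (u ++ t) z p -> ext u (raw_cat t z) p.
Proof.
case=> -> hw he; rewrite raw_cat_cat in hw he *.
move: hw he; rewrite walk_cat walk_end_cat => /andP[hu ht] he; split=> //.
by rewrite (raw_cat_src ht he).
Qed.

(* The sets whose characteristic functions span D(X). *)
Definition basic (A : set bpath) : Prop :=
  (exists2 c, c <> 1%g & A = X c) \/ exists v, A = Xv v.

Lemma basicI A B : basic A -> basic B ->
  [\/ A `&` B = A, A `&` B = B | A `&` B = set0].
Proof.
move=> bA bB.
have [->|/set0P[xi0 [Ax Bx]]] := eqVneq (A `&` B) set0; first exact: Or33.
have red C : basic C -> C xi0 -> (exists v, C = Xv v) \/ exists a, C = X (fword a).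
  case=> [[c c1 ->]|]; last by left.
  by case: (X_shape c1) => [->//||]; [left|right].
have vv v v' : Xv v xi0 -> Xv v' xi0 -> Xv v = Xv v' by rewrite /Xv /= => <- <-.
have av a v : X (fword a) xi0 -> Xv v xi0 -> X (fword a) `<=` Xv v.
  have sa eta : begins a eta -> bsrc eta = fsrc a.
    by move=> /beginsP[z [h ->]]; rewrite /bsrc (raw_cat_src (fwalk a) h).
  by move=> /X_fword/sa h; rewrite /Xv /= h => <- eta /X_fword/sa.
have sub a t a' : fseq a' = fseq a ++ t -> X (fword a') `<=` X (fword a).
  move=> ea eta /X_fword/raw_take_ext[z]; rewrite -/(flen _) ea => /ext_catl.
  by move=> /ext_raw_take h; apply/X_fword.
have [[v eA]|[a eA]] := red A bA Ax; have [[v' eB]|[a' eB]] := red B bB Bx;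
  rewrite {}eA {}eB in Ax Bx *.
- by apply: Or31; rewrite (vv _ _ Bx Ax) setIid.
- by apply: Or32; apply/setIidPr; exact: av.
- by apply: Or31; apply/setIidPl; exact: av.
have [z hz] := raw_take_ext ((X_fword a xi0).1 Ax).
have [z' hz'] := raw_take_ext ((X_fword a' xi0).1 Bx).
have [t [[et _]|[et _]]] := ext_compare hz hz'.
  by apply: Or32; apply/setIidPr; exact: sub et.
by apply: Or31; apply/setIidPl; exact: sub et.
Qed.

Lemma basicIv c v : c <> 1%g -> X c `&` Xv v = X c \/ X c `&` Xv v = set0.
Proof.
move=> c1; have [->|/set0P[xi0 [Ax Bx]]] := eqVneq (X c `&` Xv v) set0.
  by right.
left; apply/setIidPl => eta.
have sa a zeta : begins a zeta -> bsrc zeta = fsrc a.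
  by move=> /beginsP[z [h ->]]; rewrite /bsrc (raw_cat_src (fwalk a) h).
case: (X_shape c1) Ax => [->//|[v' ->]|[a ->]].
  by move: Bx; rewrite /Xv /= => <- <-.
by move: Bx; rewrite /Xv /= => <- /X_fword/sa -> /X_fword/sa ->.
Qed.

End Graph.

Arguments is_sink {E} v.
Arguments X {E} c.
Arguments Xv {E} v.
Arguments theta {E} c xi eta.

Section Span.
Variables (K : pzRingType) (V : lmodType K).

Definition linspan (S : set V) : set V :=
  [set f | exists (n : nat) (k : 'I_n -> K) (g : 'I_n -> V),
     (forall i, S (g i)) /\ f = \sum_i k i *: g i].

Lemma linspan_ind (S P : set V) : P 0 ->
  (forall k f g, P f -> P g -> P (k *: f + g)) -> S `<=` P -> linspan S `<=` P.
Proof.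
move=> P0 PD SP f [n [k [g [Sg ->]]]].
elim/big_ind: _ => //; last first.
  by move=> i _; rewrite -[_ *: _]addr0; apply: PD => //; apply: SP.
by move=> x y Px Py; rewrite -[x]scale1r; apply: PD.
Qed.

Lemma linspan0 (S : set V) : linspan S 0.
Proof.
by exists 0%N, (fun=> 0), (fun=> 0); split; [case | rewrite big_ord0].
Qed.

Lemma linspan_gen (S : set V) : S `<=` linspan S.
Proof.
by move=> f Sf; exists 1%N, (fun=> 1), (fun=> f); rewrite big_ord1 scale1r.
Qed.

Lemma linspanP (S : set V) k f g :
  linspan S f -> linspan S g -> linspan S (k *: f + g).
Proof.
move=> [n [a [u [Su ->]]]] [m [b [w [Sw ->]]]]; exists (n + m)%N.
exists (fun i => match fintype.split i with inl j => k * a j | inr j => b j end).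
exists (fun i => match fintype.split i with inl j => u j | inr j => w j end).
split; first by move=> i; case: fintype.split.
rewrite big_split_ord scaler_sumr; congr (_ + _); apply: eq_bigr => i _.
  by rewrite (unsplitK (inl i : 'I_n + 'I_m)%type) scalerA.
by rewrite (unsplitK (inr i : 'I_n + 'I_m)%type).
Qed.

End Span.

Section SkewGroupRing.
Variables (E : digraph) (K : fieldType).
Local Notation FG := (freegroup (edge E)).

(* F(X); the library's K^o is K seen as a vector space over itself. *)
Definition funX : Type := bpath E -> K^o.
HB.instance Definition _ := GRing.Lmodule.on funX.
HB.instance Definition _ := GRing.ComPzRing.on funX.
Implicit Types (f g : funX) (c p q : FG) (A : set (bpath E)).

Definition charfun A : funX := fun xi => (xi \in A)%:R.

(* f \o theta_{c^-1} on X_c, and 0 outside X_c. *)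
Definition alpha c f : funX := fun xi =>
  match pselect (exists eta, theta c^-1%g xi eta) with
  | left h => f (sval (cid h))
  | right _ => 0
  end.

Definition D0 : set funX :=
  linspan ([set charfun (X p) | p in [set p : FG | p <> 1%g]]
           `|` [set charfun (Xv v) | v in [set: vertex E]]).

(* D_p = 1_p D_0; the formula also gives D_0 itself for the neutral element,
   since then 1_p is the constant function 1. *)
Definition D p : set funX := [set charfun (X p) * f | f in D0].

Lemma funXD f g xi : (f + g) xi = f xi + g xi. Proof. by []. Qed.

Lemma funXZ (k : K) f xi : (k *: f) xi = k * f xi. Proof. by []. Qed.

Lemma funXM f g xi : (f * g) xi = f xi * g xi. Proof. by []. Qed.

Lemma funX_scalerAl (k : K) f g : k *: (f * g) = k *: f * g.
Proof. by apply/funext => xi; rewrite funXM !funXZ mulrA. Qed.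

Lemma funX_scalerAr (k : K) f g : k *: (f * g) = f * (k *: g).
Proof. by apply/funext => xi; rewrite funXM !funXZ mulrCA. Qed.

Lemma alphaE c f xi eta : theta c^-1%g xi eta -> alpha c f xi = f eta.
Proof.
move=> h; rewrite /alpha; case: pselect => [h'|[]]; last by exists eta.
by case: cid => z hz /=; rewrite (theta_fun hz h).
Qed.

Lemma alpha_out c f xi : ~ X c xi -> alpha c f xi = 0.
Proof. by move=> h; rewrite /alpha; case: pselect => // h'; case: h; apply/theta_dom. Qed.

Lemma alpha0 c : alpha c 0 = 0.
Proof. by apply/funext => xi; rewrite /alpha; case: pselect. Qed.

Lemma alphaP c k f g : alpha c (k *: f + g) = k *: alpha c f + alpha c g.
Proof.
apply/funext => xi; have [|n] := pselect (X c xi); last first.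
  by rewrite funXD funXZ !alpha_out // mulr0 addr0.
move=> /theta_dom[eta h]; rewrite funXD funXZ.
by rewrite !(alphaE _ h).
Qed.

Lemma alpha1 f : alpha 1%g f = f.
Proof.
by apply/funext => xi; rewrite (@alphaE _ _ _ xi) // invg1; exact: theta_one.
Qed.

Lemma charfunM A B : charfun A * charfun B = charfun (A `&` B).
Proof.
apply/funext => xi; rewrite funXM /charfun in_setI.
by case: (xi \in A); case: (xi \in B); rewrite ?mulr0 ?mulr1.
Qed.

Lemma charfun0 : charfun set0 = 0.
Proof. by apply/funext => xi; rewrite /charfun in_set0. Qed.

Lemma charfunT : charfun [set: bpath E] = 1.
Proof. by apply/funext => xi; rewrite /charfun in_setT. Qed.

Lemma X1 : X 1%g = [set: bpath E].
Proof. by apply/seteqP; split=> // xi _; apply: Or41. Qed.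

Lemma D0_basic A : basic A -> D0 (charfun A).
Proof.
move=> bA; apply: linspan_gen; case: bA => [[c c1 ->]|[v ->]].
  by left; exists c.
by right; exists v.
Qed.

Lemma D0_ind (P : set funX) : P 0 ->
  (forall k f g, P f -> P g -> P (k *: f + g)) ->
  (forall A, basic A -> P (charfun A)) -> D0 `<=` P.
Proof.
move=> P0 PD Pb; apply: linspan_ind => // f [[c c1 <-]|[v _ <-]]; apply: Pb.
  by left; exists c.
by right; exists v.
Qed.

Lemma D0_0 : D0 0. Proof. exact: linspan0. Qed.

Lemma D0_P k f g : D0 f -> D0 g -> D0 (k *: f + g).
Proof. exact: linspanP. Qed.

Lemma D0_M f g : D0 f -> D0 g -> D0 (f * g).
Proof.
move=> hf hg; move: f hf; apply: D0_ind.
- by rewrite mul0r; exact: D0_0.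
- by move=> k f f' h h'; rewrite mulrDl -funX_scalerAl; exact: D0_P.
move=> A bA; move: g hg; apply: D0_ind.
- by rewrite mulr0; exact: D0_0.
- by move=> k f f' h h'; rewrite mulrDr -funX_scalerAr; exact: D0_P.
move=> B bB; rewrite charfunM; case: (basicI bA bB) => ->.
- exact: D0_basic.
- exact: D0_basic.
- by rewrite charfun0; exact: D0_0.
Qed.

Lemma basicX p : p <> 1%g -> basic (X p).
Proof. by move=> p1; left; exists p. Qed.

Lemma charX_D0 p f : D0 f -> D0 (charfun (X p) * f).
Proof.
move=> hf; have [->|/eqP p1] := eqVneq p 1%g; first by rewrite X1 charfunT mul1r.
by apply: D0_M => //; apply: D0_basic; exact: basicX.
Qed.

Lemma DP p f : D p f <-> D0 f /\ (forall xi, ~ X p xi -> f xi = 0).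
Proof.
split=> [[g hg <-]|[hf h0]].
  split; first exact: charX_D0.
  by move=> xi n; rewrite funXM /charfun memNset // mul0r.
exists f => //; apply/funext => xi; rewrite funXM /charfun.
have [hx|n] := pselect (X p xi); first by rewrite mem_set // mul1r.
by rewrite memNset // mul0r h0.
Qed.

Lemma D_0 p : D p 0. Proof. by apply/DP; split => //; exact: D0_0. Qed.

Lemma D_P p k f g : D p f -> D p g -> D p (k *: f + g).
Proof.
move=> /DP[hf f0] /DP[hg g0]; apply/DP; split; first exact: D0_P.
move=> xi n; rewrite funXD funXZ.
by rewrite f0 // g0 // mulr0 addr0.
Qed.

Lemma X_theta p q xi eta : theta p^-1%g xi eta -> X q eta <-> X (p * q)%g xi.
Proof.
move=> h; split=> /theta_dom[zeta hz]; apply/theta_dom; exists zeta.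
  by rewrite invgM; exact: theta_comp h hz.
have := theta_comp (theta_inv h) hz.
by rewrite invgK invgM mulgVK.
Qed.

Lemma alphaX p q :
  alpha p (charfun (X p^-1%g) * charfun (X q)) = charfun (X p) * charfun (X (p * q)%g).
Proof.
apply/funext => xi; rewrite funXM.
have [hx|n] := pselect (X p xi); last first.
  by rewrite alpha_out // /charfun (memNset n) mul0r.
have [eta h] := (theta_dom _ _).1 hx; rewrite (alphaE _ h) funXM.
have hy : X p^-1%g eta by have := theta_domV (theta_inv h); rewrite invgK.
rewrite /charfun (mem_set hx) (mem_set hy) !mul1r; congr (_%:R).
by congr nat_of_bool; apply/idP/idP => /set_mem/(X_theta q h)/mem_set.
Qed.

Lemma alpha_D0 p f : D0 f -> D0 (alpha p (charfun (X p^-1%g) * f)).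
Proof.
have [->|/eqP p1] := eqVneq p 1%g.
  by rewrite invg1 X1 charfunT mul1r alpha1.
have aX q : D0 (alpha p (charfun (X p^-1%g) * charfun (X q))).
  by rewrite alphaX mulrC; apply: charX_D0; apply: D0_basic; exact: basicX.
move: f; apply: D0_ind.
- by rewrite mulr0 alpha0; exact: D0_0.
- by move=> k f g hf hg; rewrite mulrDr -funX_scalerAr alphaP; exact: D0_P.
move=> A [[c _ ->]|[v ->]]; first exact: aX.
have p1' : (p^-1)%g <> 1%g by move=> e; apply: p1; rewrite -[p]invgK e invg1.
rewrite charfunM; case: (basicIv v p1') => ->; last first.
  by rewrite charfun0 alpha0; exact: D0_0.
by rewrite -[charfun _]mulr1 -charfunT -X1; exact: aX.
Qed.

Lemma alpha_D p f : D p^-1%g f -> D p (alpha p f).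
Proof.
case=> g hg <-; apply/DP; split; first exact: alpha_D0.
by move=> xi; exact: alpha_out.
Qed.

(* The coefficient alpha_p(alpha_{p^-1}(a) b) of a delta_p . b delta_q. *)
Definition coef_mul p f g : funX := alpha p (alpha p^-1%g f * g).

Lemma coef_mul_D p q f g : D p f -> D q g -> D (p * q)%g (coef_mul p f g).
Proof.
move=> hf /DP[hg g0]; have hf' : D p^-1%g (alpha p^-1%g f).
  by apply: alpha_D; rewrite invgK.
have [k hk ek] := hf'; apply/DP; split.
  by rewrite /coef_mul -ek -mulrA; apply: alpha_D0; exact: D0_M.
move=> xi n; have [/theta_dom[eta h]|n'] := pselect (X p xi); last exact: alpha_out.
rewrite /coef_mul (alphaE _ h) funXM g0 ?mulr0 //.
by move/(X_theta _ h).
Qed.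

Definition is_skew (x : FG -> funX) : Prop :=
  finite_set [set p | x p <> 0] /\ forall p, D p (x p).

Definition skew_pred : {pred FG -> funX} := fun x => `[< is_skew x >].

(* The finite formal sums \sum_p x_p delta_p with x_p in D_p. *)
Record skew_ring := SkewRing { skew_coef :> FG -> funX; _ : skew_coef \in skew_pred }.

HB.instance Definition _ := [isSub for skew_coef].
HB.instance Definition _ := [Choice of skew_ring by <:].

Lemma skew_predP x : reflect (is_skew x) (x \in skew_pred).
Proof. exact: asboolP. Qed.

Lemma skew_submod : submod_closed skew_pred.
Proof.
split.
  apply/skew_predP; split; last by move=> p; exact: D_0.
  by rewrite [X in finite_set X](_ : _ = set0) //; apply/seteqP; split.
move=> k x y /skew_predP[fx Dx] /skew_predP[fy Dy]; apply/skew_predP; split.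
  apply: sub_finite_set (_ : _ `<=` [set p | x p <> 0] `|` [set p | y p <> 0]) _.
    move=> p /= n; apply: contrapT => /not_orP[/contrapT xp /contrapT yp].
    by apply: n; rewrite -[LHS]/(k *: x p + y p) xp yp scaler0 addr0.
  by rewrite finite_setU.
by move=> p; exact: D_P.
Qed.

HB.instance Definition _ :=
  GRing.isSubmodClosed.Build _ _ skew_pred skew_submod.
HB.instance Definition _ := [SubChoice_isSubLmodule of skew_ring by <:].

Definition delta p f : FG -> funX := fun q => if q == p then f else 0.

Lemma delta_skew p f : D p f -> delta p f \in skew_pred.
Proof.
move=> hf; apply/skew_predP; split; last first.
  by move=> q; rewrite /delta; case: eqP => [->|_] //; exact: D_0.
by apply: sub_finite_set (finite_set1 p) => q; rewrite /delta /=; case: eqP.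
Qed.

(* The bilinear extension of
   (a delta_p) (b delta_q) = alpha_p(alpha_{p^-1}(a) b) delta_{pq}. *)
Definition skew_mul_fun (x y : skew_ring) : FG -> funX :=
  \sum_(p \in [set p | x p <> 0]) \sum_(q \in [set q | y q <> 0])
    delta (p * q)%g (coef_mul p (x p) (y q)).

Lemma skewD (x : skew_ring) p : D p (x p).
Proof. by case: x => x /= /skew_predP[]. Qed.

Lemma skew_fin (x : skew_ring) : finite_set [set p | x p <> 0].
Proof. by case: x => x /= /skew_predP[]. Qed.

Lemma skew_mul_subproof x y : skew_mul_fun x y \in skew_pred.
Proof.
rewrite /skew_mul_fun fsbig_finite; last exact: skew_fin.
apply: rpred_sum => p _; rewrite fsbig_finite; last exact: skew_fin.
apply: rpred_sum => q _; apply: delta_skew; apply: coef_mul_D; exact: skewD.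
Qed.

Definition skew_mul (x y : skew_ring) : skew_ring := SkewRing (skew_mul_subproof x y).

Lemma skew_mul_delta p q f g (hf : D p f) (hg : D q g) :
  skew_mul (SkewRing (delta_skew hf)) (SkewRing (delta_skew hg)) =
  SkewRing (delta_skew (coef_mul_D hf hg)).
Proof.
apply: val_inj => /=; rewrite /skew_mul_fun.
have c0 r h : coef_mul r 0 h = 0 by rewrite /coef_mul alpha0 mul0r alpha0.
have c0r r h : coef_mul r h 0 = 0 by rewrite /coef_mul mulr0 alpha0.
have d0 r : delta r 0 = 0 by apply/funext => s; rewrite /delta; case: ifP.
have sub r h : [set s | delta r h s <> 0] `<=` [set r].
  by move=> s; rewrite /delta /=; case: eqP.
rewrite (fsbig_widen _ [set p] _ (@sub p f)); last first.
  move=> r [_ /= /contrapT ->]; rewrite fsbig1 // => s _.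
  by rewrite c0 d0.
rewrite fsbig_set1 (fsbig_widen _ [set q] _ (@sub q g)); last first.
  by move=> r [_ /= /contrapT ->]; rewrite c0r d0.
have dE r h : delta r h r = h by rewrite /delta eqxx.
by rewrite fsbig_set1 /= !dE.
Qed.

Lemma charfun_Xv_D1 v : D 1%g (charfun (Xv v)).
Proof.
exists (charfun (Xv v)); last by rewrite X1 charfunT mul1r.
by apply: D0_basic; right; exists v.
Qed.

Definition skew_vertex v : skew_ring := SkewRing (delta_skew (charfun_Xv_D1 v)).

End SkewGroupRing.

Arguments skew_mul {E K} x y.
Arguments skew_vertex {E} K v.

(* Main.v *)
Require Import Defs.
From mathcomp Require Import all_boot all_algebra zify.
From mathcomp Require Import boolp classical_sets functions cardinality fsbigop.

Set Implicit Arguments.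
Unset Strict Implicit.
Unset Printing Implicit Defensive.

Import GRing.Theory.
Local Open Scope ring_scope.

(** The kernel of [phi] is a two-sided ideal, so the claim is that a nonzero
    ideal of the skew group ring contains [1_v delta_0] for some vertex [v].

    Write [cyl n xi] for the set of boundary paths that share their source and
    their first [n] edges with [xi]. Three facts about these cylinders suffice.
    The functions of [D(X)] are locally constant with respect to them
    ([D0_locally_constant]). A cylinder is either some [X_v] or some [X_a] with
    [a] a path ([cyl_basic]); in the second case conjugating [1_a delta_0] by
    [1_a delta_a] gives the vertex [r(a)] ([conj_word]). Finally, condition (L)
    makes the partial action topologically free: if [c] is not the neutral
    element, then every cylinder contains a point that [theta_c] does not fix
    ([not_fixed]). Indeed, a fixed point of [theta_c] has the form
    [u t t t ...], where the closed path [t] and the prefix [u] depend on [c]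
    only; leaving [t] through an exit after many turns gives a nearby point
    that is not of this form.

    Let now [x] be a nonzero element of an ideal. Translate it so that its
    coefficient at the neutral element is nonzero, and choose a cylinder on
    which this coefficient is a nonzero constant [k]. By topological freeness
    and continuity it contains a smaller cylinder [A] such that no [theta_c],
    for the finitely many other [c] in the support of [x], maps a point of [A]
    into [A] ([separating_cylinder]). Multiplying [x] by [1_A delta_0] on both
    sides kills the terms at these [c] and leaves [k 1_A delta_0] ([compress]),
    so [1_A delta_0] lies in the ideal, and with it some vertex. *)

Section Cylinders.
Local Open Scope classical_set_scope.
Variable E : digraph.
Implicit Types (v : vertex E) (xi eta : bpath E) (p z : rawpath E).

(** * Prefixes and cylinders *)

Lemma take_raw_take m n p : (m <= n)%N -> take m (raw_take n p) = raw_take m p.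
Proof.
move=> mn; case: p => [v w|x] /=; first by rewrite take_takel.
by rewrite /mkseq -map_take take_iota (minn_idPl mn).
Qed.

Lemma size_raw_take n p : (size (raw_take n p) <= n)%N.
Proof. by case: p => [v w|x] /=; rewrite ?size_mkseq // size_take; case: ltnP. Qed.

Lemma raw_take_cat m w p : raw_take (size w + m) (raw_cat w p) = w ++ raw_take m p.
Proof.
elim: w => [//|e w IHw] /=; rewrite -IHw.
case: (raw_cat w p) => [//|x]; rewrite /= /mkseq /=.
by rewrite (iotaDl 1 0) -map_comp.
Qed.

Lemma raw_take_extD m w z p : ext w z p -> raw_take (size w + m) p = w ++ raw_take m z.
Proof. by case=> -> _ _; exact: raw_take_cat. Qed.

Lemma raw_take_sink m xi : is_sink (bsrc xi) -> raw_take m xi = [::].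
Proof.
have := brawP xi; rewrite /bsrc.
case: (braw xi) => [v [|e w]|x] // => [[/= /andP[/eqP ev _] _]|_] sx.
  by case: (sx e).
by case: (sx (x 0%N)).
Qed.

Lemma bpath_ext xi eta : bsrc xi = bsrc eta ->
  (forall n, raw_take n xi = raw_take n eta) -> xi = eta.
Proof.
move=> es et; apply: braw_inj; move: es et; rewrite /bsrc.
have fin_inf v w x : ~ forall n, raw_take n (@Fin E v w) = raw_take n (Inf x).
  move/(_ (size w).+1)/(congr1 size); rewrite [in RHS]size_mkseq /=.
  by rewrite take_oversize //; lia.
case: (braw xi) => [v w|x]; case: (braw eta) => [v' w'|y] es et.
- have := et (maxn (size w) (size w')); rewrite /= in es *.
  by rewrite !take_oversize ?leq_maxl ?leq_maxr // es => ->.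
- by case: (fin_inf _ _ _ et).
- by case: (fin_inf v' w' x) => n; rewrite et.
congr Inf; apply/funext => i; have /(congr1 (fun s => nth (x i) s i)) := et i.+1.
by rewrite /= !nth_mkseq.
Qed.

(** The source is recorded separately because an empty prefix does not determine
    it. If [xi] is finite and [n] is at least its length, the cylinder is the
    singleton of [xi]: a path that starts with all of [xi] has reached a sink. *)
Definition cyl n xi : set (bpath E) :=
  [set eta | bsrc eta = bsrc xi /\ raw_take n eta = raw_take n xi].

Lemma cyl_refl n xi : cyl n xi xi. Proof. by []. Qed.

Lemma cyl_sub m n xi eta : (m <= n)%N -> cyl m xi eta -> cyl n eta `<=` cyl m xi.
Proof.
move=> mn [es et] zeta [zs zt]; split; first by rewrite zs.
by rewrite -(take_raw_take _ mn) zt take_raw_take.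
Qed.

(** The prefix may be shorter than [n], but then it is all of [xi] and ends at a
    sink, where no path can continue. *)
Lemma cyl_prefix n xi eta : bsrc eta = bsrc xi ->
  raw_take (size (raw_take n xi)) eta = raw_take n xi -> cyl n xi eta.
Proof.
move=> es et; split=> //.
have [sn|sn] := eqVneq (size (raw_take n xi)) n; first by rewrite sn in et.
have [z hz] := raw_take_ext et.
suff [sz ln] : is_sink (bsrc z) /\ (size (raw_take n xi) <= n)%N.
  by have := raw_take_extD (n - size (raw_take n xi)) hz;
    rewrite subnKC // (raw_take_sink _ sz) cats0.
case: hz => _ _; rewrite -/(bsrc eta) es /bsrc => <-.
case: xi (brawP xi) sn {es et} => -[v w|x] ? /=; last by rewrite size_mkseq eqxx.
rewrite size_take; case: ltnP => // nw; first by rewrite eqxx.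
by rewrite take_oversize // => -[].
Qed.

Lemma cyl_basic n xi :
  cyl n xi = Xv (bsrc xi) \/ exists a, cyl n xi = X (fword a).
Proof.
case ew: (raw_take n xi) => [|e w].
  left; apply/seteqP; split=> [eta []//|eta es]; apply: cyl_prefix => //.
  by rewrite ew; case: (braw eta) => //= v u; rewrite take0.
right; have tw : raw_take (size (e :: w)) xi = e :: w.
  by rewrite -ew -(@take_raw_take _ n) ?size_raw_take // take_size.
have [z hz] := raw_take_ext tw; have [a ea _] := ext_fpath hz.
have [_ /= /andP[/eqP se _] _] := hz.
exists a; apply/seteqP; split=> eta.
  move=> [es et]; apply/X_fword; rewrite /begins /flen ea.
  by rewrite -(@take_raw_take _ n) ?et -ew ?size_raw_take // take_size.
move=> /X_fword; rewrite /begins /flen ea => et; apply: cyl_prefix; last first.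
  by rewrite ew.
have [z' [_ /= /andP[/eqP se' _] _]] := raw_take_ext et.
by rewrite /bsrc -se -se'.
Qed.

Lemma basic_cyl A xi : basic A -> exists n, forall eta, cyl n xi eta -> (A eta <-> A xi).
Proof.
have hv v : exists n, forall eta, cyl n xi eta -> (Xv v eta <-> Xv v xi).
  by exists 0%N => eta [es _]; rewrite /Xv /= es.
case=> [[c c1 ->]|[v ->]]; last exact: hv.
case: (X_shape c1) => [->|[v ->]|[a ->]]; [by exists 0%N | exact: hv |].
by exists (flen a) => eta [_ et]; split=> /X_fword h; apply/X_fword;
  rewrite /begins ?et // -et.
Qed.

(** Either some path from [v] reaches a sink, or iterating a choice of outgoing
    edges never gets stuck. *)
Lemma bpath_exists v : exists xi, bsrc xi = v.
Proof.
have [[w [hw sw]]|nosink] := pselect (exists w, walk v w /\ is_sink (walk_end v w)).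
  by exists (@BPath _ (Fin v w) (conj hw sw)).
have ns w : walk v w -> exists e, src e = walk_end v w.
  move=> hw; apply: contrapT => h; apply: nosink; exists w; split=> // e es.
  by apply: h; exists e.
have [e0 es0] := ns [::] isT.
have next (u : vertex E) : exists f, (exists e, src e = u) -> src f = u.
  by have [[e <-]|n] := pselect (exists e, src e = u); [exists e | exists e0].
have [g gP] := choice next.
pose x i := iter i (fun e => g (rng e)) e0.
have wx i : walk v (mkseq x i.+1) /\ walk_end v (mkseq x i.+1) = rng (x i).
  elim: i => [|i [IH1 IH2]]; first by rewrite /= es0 eqxx.
  rewrite mkseqS -cats1 walk_cat walk_end_cat IH1 IH2 /= andbT; split=> //.
  by apply/eqP/gP; rewrite -IH2; exact: ns.
have bx : is_boundary (Inf x).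
  by move=> i /=; apply/esym/gP; have [/ns h <-] := wx i.
by exists (BPath bx).
Qed.

(** * Topological freeness *)

Lemma ext_exists v w : walk v w ->
  exists xi (z : bpath E), ext w z xi /\ bsrc xi = v.
Proof.
move=> hw; have [z /esym hz] := bpath_exists (walk_end v w).
exists (BPath (raw_cat_boundary (brawP z) hw hz)), z.
by split; [exact: ext_src hw hz | exact: raw_cat_src hw hz].
Qed.

Lemma ext_cancel u t z z' p : ext (u ++ t) z p -> ext u z' p -> ext t z z'.
Proof.
move=> h h'; have [s [[]|[]]] := ext_compare h' h.
  by move/eqP; rewrite eqseq_cat // eqxx => /eqP ->.
move/(congr1 size); rewrite !size_cat => e.
have [t0 s0] : size t = 0%N /\ size s = 0%N by lia.
rewrite (size0nil t0) (size0nil s0) => -[/= -> _ _]; exact: ext_nil.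
Qed.

(** The defining cases of [theta] already present [c] in reduced form, which
    makes [u] and [w] functions of [c]; [theta_ext] uses this to read off any
    pair of [theta_c] along one and the same decomposition. *)
Lemma theta_irred c xi eta : theta c xi eta ->
  exists u w (z : bpath E), [/\ irred w u, c = (word w * (word u)^-1)%g,
    ext u z xi & ext w z eta].
Proof.
case=> {c xi eta} [xi|b xi h|b xi h|a b xi ha hb nab].
- by exists [::], [::], xi; split; rewrite ?mulgV //; exact: irred_nill.
- exists [::], (fseq b), xi; split; [exact: irred_nilr| |exact: ext_nil|exact: ext_bcat].
  by rewrite invg1 mulg1.
- exists (fseq b), [::], xi; split; [exact: irred_nill| |exact: ext_bcat|exact: ext_nil].
  by rewrite mul1g.
- by exists (fseq b), (fseq a), xi; split=> //; [exact: irred_fpath|exact: ext_bcat..].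
Qed.

Lemma theta_ext u w xi eta : irred w u ->
  theta (word w * (word u)^-1)%g xi eta ->
  exists z : bpath E, ext u z xi /\ ext w z eta.
Proof.
move=> i /theta_irred[u' [w' [z [i' e hu hw]]]].
have [ew eu] := irred_uniq i i' e; subst u' w'; by exists z.
Qed.

Lemma ext_pow t z k : ext t z z -> ext (flatten (nseq k t)) z z.
Proof.
by move=> h; elim: k => [|k IHk] /=; [exact: ext_nil | exact: ext_comp IHk h].
Qed.

(** Here [xi = u z] with [z = t t t ...]. The point [eta] runs around [t] often
    enough to stay in the cylinder and then leaves through an exit; it still
    starts with [u], but what follows is no longer invariant under prepending
    [t], since that would force it to start with [n + 1] copies of [t]. *)
Lemma cycle_exit u t (z xi : bpath E) n : condition_L E -> t <> [::] ->
  ext t z z -> ext u z xi ->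
  exists2 eta, cyl n xi eta &
    forall z' : bpath E, ext u z' eta -> ~ ext t z' z'.
Proof.
case: t => // f t cL _ ht hu.
have [b eb rb] := ext_fpath ht.
have sb : fsrc b = frng b.
  rewrite rb; have [_ /= /andP[/eqP <- _] _] := ht.
  by case: eb => + _; rewrite /fsrc => ->.
have [i ib [e [se ne]]] := cL b sb; set t' := f :: t in ht eb.
rewrite /flen /fnth eb in ib se ne; set d := fhead b in se ne.
pose T := flatten (nseq n t').
have hT : ext T z z by exact: ext_pow.
have sT : (n <= size T)%N.
  by rewrite /T; elim: (n) => //= k IHk; rewrite size_cat /=; lia.
(* The part of t before the exit, followed by the exit. *)
pose s := take i t' ++ [:: e].
have [eT wT rT] := ext_comp hT hu.
have ws : walk (bsrc xi) ((u ++ T) ++ s).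
  rewrite walk_cat wT rT /s.
  have [_ + _] := ht; rewrite -{1}(cat_take_drop i t') (drop_nth d) // !walk_cat /=.
  by rewrite se andbT => /andP[-> /andP[/eqP -> _]] /=.
have [eta [y [hy sy]]] := ext_exists ws.
exists eta.
  have e1 := ext_raw_take (ext_catl hy); have e2 := ext_raw_take (ext_comp hT hu).
  have le : (n <= size (u ++ T))%N by rewrite size_cat; lia.
  by split=> //; rewrite -(take_raw_take _ le) e1 -e2 take_raw_take.
move=> z' hz' hz.
rewrite -catA in hy; have := ext_raw_take (ext_cancel hy hz').
have := ext_raw_take (ext_comp hz (ext_pow n hz)); rewrite -/t' -/T => e1.
(* Compare the edge at position size T + i in both prefixes of z'. *)
have ss : size (T ++ s) = (size T + i.+1)%N.
  by rewrite /s !size_cat size_takel /= ?addn1 // ltnW.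
rewrite -(@take_raw_take _ (size (T ++ t'))) ?e1; last by rewrite ss size_cat leq_add2l.
rewrite ss takeD take_size_cat // drop_size_cat // => /eqP.
rewrite eqseq_cat // eqxx andTb /s (take_nth d) // -cats1 eqseq_cat // eqxx andTb.
rewrite eqseq_cons andbT => /eqP/esym; exact: ne.
Qed.

(** If [theta_c] fixes [xi] and [c = w u^-1] is reduced, then one of [u] and [w]
    extends the other by a nonempty [t], and [xi] is the common part followed by
    [t t t ...]; a point beside it is not fixed because [u] and [w] are
    determined by [c]. *)
Lemma not_fixed c xi n : condition_L E -> c <> 1%g ->
  exists2 eta, cyl n xi eta & ~ theta c eta eta.
Proof.
move=> cL c1; have [hx|] := pselect (theta c xi xi); last by exists xi.
have [u [w [z [irr ec hu hw]]]] := theta_irred hx.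
have uw : u <> w by move=> uw; apply: c1; rewrite ec uw mulgV.
have [t [[e ht]|[e ht]]] := ext_compare hu hw.
  have t0 : t <> [::] by move=> t0; apply: uw; rewrite e t0 cats0.
  have [eta ceta neta] := cycle_exit n cL t0 ht hu; exists eta => //.
  rewrite ec => /(theta_ext irr)[z' [hu' hw']].
  by apply: (neta z' hu'); rewrite e in hw'; exact: ext_cancel hw' hu'.
have t0 : t <> [::] by move=> t0; apply: uw; rewrite e t0 cats0.
have [eta ceta neta] := cycle_exit n cL t0 ht hw; exists eta => //.
rewrite ec => /(theta_ext irr)[z' [hu' hw']].
by apply: (neta z' hw'); rewrite e in hu'; exact: ext_cancel hu' hw'.
Qed.

Lemma ext_cyl k w n (z z' : bpath E) xi eta : ext w z xi -> ext w z' eta ->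
  (k + size w <= n)%N -> cyl n xi eta -> cyl k z z'.
Proof.
move=> h h' kn [es et]; split.
  have [_ _ hz] := h; have [_ _ hz'] := h'; move: es; rewrite /bsrc => es.
  by rewrite -hz -hz' es.
have := take_raw_take eta kn; rewrite et take_raw_take //.
rewrite addnC (raw_take_extD _ h) (raw_take_extD _ h') => /eqP.
by rewrite eqseq_cat // eqxx /= => /eqP/esym.
Qed.

Lemma cyl_sym n xi eta : cyl n xi eta -> cyl n eta xi.
Proof. by case=> es et; split. Qed.

(** Continuity of [theta_c]: if pairs of [theta_c] accumulated at [(xi, xi)],
    both words of the reduced form of [c] would be prefixes of [xi], and the
    two remainders would agree on all prefixes, so [theta_c] would fix [xi]. *)
Lemma theta_separate c xi : ~ theta c xi xi ->
  exists n, forall eta zeta, cyl n xi eta -> cyl n xi zeta -> ~ theta c eta zeta.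
Proof.
move=> nfix; apply: contrapT => all.
have {}all n : exists eta zeta, [/\ cyl n xi eta, cyl n xi zeta & theta c eta zeta].
  apply: contrapT => h; apply: all; exists n => eta zeta h1 h2 h3.
  by apply: h; exists eta, zeta.
have [_ [_ [_ _ /theta_irred[u [w [_ [irr ec _ _]]]]]]] := all 0%N.
have {}all n : exists eta zeta (y : bpath E),
    [/\ cyl n xi eta, cyl n xi zeta, ext u y eta & ext w y zeta].
  have [eta [zeta [h1 h2]]] := all n; rewrite ec => /(theta_ext irr)[y [h3 h4]].
  by exists eta, zeta, y.
pose m := maxn (size u) (size w).
have pre s : (size s <= m)%N -> forall eta (y : bpath E), cyl m xi eta -> ext s y eta ->
    exists z : bpath E, ext s z xi.
  move=> sm eta y [_ et] h; apply: raw_take_ext.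
  by rewrite -(take_raw_take _ sm) -et take_raw_take // (ext_raw_take h).
have [eta [zeta [y [h1 h2 h3 h4]]]] := all m.
have [z hz] := pre u (leq_maxl _ _) _ _ h1 h3.
have [z' hz'] := pre w (leq_maxr _ _) _ _ h2 h4.
suff ez : z = z'.
  subst z'; apply: nfix; apply/thetaE; exists u, w, z; split=> //.
have zz k : cyl k z z'.
  have [eta' [zeta' [y' [g1 g2 g3 g4]]]] := all (k + m)%N.
  have ku : cyl k z y' by apply: ext_cyl hz g3 _ g1; rewrite leq_add2l leq_maxl.
  have kw : cyl k z' y' by apply: ext_cyl hz' g4 _ g2; rewrite leq_add2l leq_maxr.
  exact: cyl_sub (leqnn k) ku _ (cyl_sym kw).
by apply: bpath_ext => [|k]; [case: (zz 0%N) | case: (zz k)].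
Qed.

(** The property is inherited by smaller cylinders, so the elements of [F] can be
    treated one after the other. *)
Lemma separating_cylinder (F : seq (freegroup (edge E))) xi n : condition_L E ->
  exists eta m, cyl m eta `<=` cyl n xi /\
    forall c, c \in F -> c <> 1%g -> forall zeta zeta', cyl m eta zeta ->
      cyl m eta zeta' -> ~ theta c zeta zeta'.
Proof.
move=> cL; elim: F => [|c F [eta [m [sub IH]]]]; first by exists xi, n; split.
have [->|/eqP c1] := eqVneq c 1%g.
  by exists eta, m; split=> // d; rewrite inE => /orP[/eqP -> //|dF]; exact: IH.
have [xi' hx' nf] := not_fixed eta m cL c1.
have [k hk] := theta_separate nf; pose l := maxn m k.
have sm : cyl l xi' `<=` cyl m eta by exact: cyl_sub (leq_maxl m k) hx'.
have sk : cyl l xi' `<=` cyl k xi' by apply: cyl_sub (leq_maxr m k) _.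
exists xi', l; split; first exact: subset_trans sm sub.
move=> d; rewrite inE => /orP[/eqP -> _|dF d1] zeta zeta' h h'.
  by apply: hk; exact: sk.
by apply: IH => //; exact: sm.
Qed.
End Cylinders.

Section SkewRing.
Local Open Scope classical_set_scope.
Variables (E : digraph) (K : fieldType).
Local Notation FG := (freegroup (edge E)).
Implicit Types (f g : funX E K) (p q r : FG) (x y : skew_ring E K).

(** * Products in the skew group ring *)

Lemma D0_locally_constant f xi : D0 f ->
  exists n, forall eta, cyl n xi eta -> f eta = f xi.
Proof.
move: f; apply: D0_ind; first by exists 0%N.
  move=> k f g [n hn] [m hm]; exists (maxn n m) => eta h.
  have hs i : (i <= maxn n m)%N -> cyl i xi eta.
    by move=> le; apply: cyl_sub le (cyl_refl i xi) _ h.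
  by rewrite !funXD !funXZ hn ?hm //; apply: hs; rewrite ?leq_maxl ?leq_maxr.
move=> A /(basic_cyl xi)[n hn]; exists n => eta /hn h; rewrite /charfun.
by congr (_%:R); congr nat_of_bool; apply/idP/idP => /set_mem/h/mem_set.
Qed.

Definition single p f (h : D p f) : skew_ring E K := SkewRing (delta_skew h).

Lemma delta0 p : delta p (0 : funX E K) = 0.
Proof. by apply/funext => q; rewrite /delta; case: ifP. Qed.

Lemma delta_support p f : [set q | delta p f q <> 0] `<=` [set p].
Proof. by move=> q; rewrite /delta /=; case: eqP. Qed.

Lemma deltaE p f : delta p f p = f. Proof. by rewrite /delta eqxx. Qed.

Lemma coef_mul0l p g : coef_mul p 0 g = 0.
Proof. by rewrite /coef_mul alpha0 mul0r alpha0. Qed.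

Lemma coef_mul0r p f : coef_mul p f 0 = 0.
Proof. by rewrite /coef_mul mulr0 alpha0. Qed.

(** At the point [s p] only the summand of index [p] contributes, by injectivity
    of the translation [s]; if [p] lies outside [A] both sides vanish. *)
Lemma sum_delta (A : set FG) (s : FG -> FG) (G : FG -> funX E K) p :
  finite_set A -> injective s -> (forall q, ~ A q -> G q = 0) ->
  (\sum_(q \in A) delta (s q) (G q)) (s p) = G p.
Proof.
move=> fA si G0.
have ev q : delta (s q) (G q) (s p) = if p == q then G p else 0.
  by rewrite /delta (inj_eq si); case: eqP => [->|].
rewrite fsbig_finite //.
rewrite (big_morph (fun h : FG -> funX E K => h (s p)) (id1 := 0) (op1 := +%R)) //.
have [Ap|nAp] := pselect (A p).
  rewrite (bigD1_seq p) ?in_fset_set ?mem_set ?finmap.fset_uniq //= deltaE.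
  by rewrite big1 ?addr0 // => q qp; rewrite ev eq_sym (negPf qp).
by rewrite G0 // big1 // => q _; rewrite ev G0 //; case: eqP.
Qed.

Lemma skew_mul_singler x q g (h : D q g) p :
  skew_mul x (single h) (p * q)%g = coef_mul p (x p) g.
Proof.
have inner r : \sum_(q' \in [set q' | single h q' <> 0])
    delta (r * q')%g (coef_mul r (x r) (single h q')) = delta (r * q)%g (coef_mul r (x r) g).
  rewrite (fsbig_widen _ [set q] _ (@delta_support q g)); last first.
    by move=> q' [_ /= /contrapT ->]; rewrite coef_mul0r delta0.
  by rewrite fsbig_set1 /= deltaE.
rewrite /= /skew_mul_fun; under eq_fsbigr => r _ do rewrite (inner r).
apply: (@sum_delta _ (fun r => r * q)%g (fun r => coef_mul r (x r) g)).
- exact: skew_fin.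
- exact: mulIg.
- by move=> r /= /contrapT ->; rewrite coef_mul0l.
Qed.

Lemma skew_mul_singlel y p f (h : D p f) q :
  skew_mul (single h) y (p * q)%g = coef_mul p f (y q).
Proof.
rewrite /= /skew_mul_fun (fsbig_widen _ [set p] _ (@delta_support p f)); last first.
  by move=> r [_ /= /contrapT ->]; rewrite fsbig1 // => s _; rewrite coef_mul0l delta0.
rewrite fsbig_set1 /= deltaE.
apply: (@sum_delta _ (fun r => p * r)%g (fun r => coef_mul p f (y r))).
- exact: skew_fin.
- exact: mulgI.
- by move=> r /= /contrapT ->; rewrite coef_mul0r.
Qed.

Lemma D_charX p : p <> 1%g -> D p (charfun K (X p)).
Proof.
move=> p1; apply/DP; split; first exact/D0_basic/basicX.
by move=> xi n; rewrite /charfun memNset.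
Qed.

Lemma coef_mul_char p f : D p f -> coef_mul p f (charfun K (X p^-1%g)) = f.
Proof.
case/DP=> _ f0; apply/funext => xi; rewrite /coef_mul.
have [|n] := pselect (X p xi); last by rewrite alpha_out // f0.
move=> /theta_dom[eta h]; have h' := theta_inv h.
rewrite (alphaE _ h) funXM (alphaE _ h') /charfun mem_set ?mulr1 //.
by have := theta_domV h'; rewrite invgK.
Qed.

Lemma D0_cyl n (xi : bpath E) : D0 (charfun K (cyl n xi)).
Proof.
apply: D0_basic; have [->|[a ->]] := cyl_basic n xi; first by right; exists (bsrc xi).
by apply: basicX; exact: word_neq1.
Qed.

Lemma D1 f : D0 f -> D 1%g f.
Proof. by move=> hf; apply/DP; split=> // xi []; rewrite X1. Qed.

(** The coefficient of the product at [p] takes the value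
    [x_p(xi) 1_A(xi) 1_A(eta)] at a point [xi = theta_p(eta)]; by separation this
    is zero unless [p] is the neutral element. *)
Lemma compress A (hA : D 1%g (charfun K A)) x (k : K) :
  (forall xi, A xi -> x 1%g xi = k) ->
  (forall p, x p <> 0 -> p <> 1%g -> forall xi eta, A xi -> A eta -> ~ theta p xi eta) ->
  skew_mul (skew_mul (single hA) x) (single hA) = k *: single hA.
Proof.
move=> hk sep; apply: val_inj; apply/funext => p.
rewrite -[p]mulg1 [LHS]skew_mul_singler.
rewrite -[p in X in coef_mul _ X _]mul1g skew_mul_singlel mulg1.
have c1 g : coef_mul 1%g (charfun K A) g = charfun K A * g.
  by rewrite /coef_mul invg1 !alpha1.
rewrite c1; have [->|/eqP p1] := eqVneq p 1%g.
  rewrite /coef_mul invg1 !alpha1 /= -[RHS]/(k *: delta 1%g (charfun K A) 1%g) deltaE.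
  apply/funext => xi; rewrite !funXM funXZ /charfun.
  by case: (boolP (xi \in A)) => [/set_mem/hk ->|_]; rewrite ?mul0r ?mulr0 // mul1r.
rewrite -[RHS]/(k *: delta 1%g (charfun K A) p) /delta (negPf (introN eqP p1)) scaler0.
have [->|/eqP xp] := eqVneq (x p) 0; first by rewrite mulr0 coef_mul0l.
apply/funext => xi; rewrite /coef_mul.
have [/theta_dom[eta h]|n] := pselect (X p xi); last by rewrite alpha_out.
have h' := theta_inv h; rewrite (alphaE _ h) funXM (alphaE _ h') funXM /charfun.
case: (boolP (eta \in A)) => [/set_mem Ae|_]; last by rewrite mulr0.
case: (boolP (xi \in A)) => [/set_mem Ax|_]; last by rewrite !mul0r.
by case: (sep p xp p1 eta xi Ae Ax); rewrite invgK in h'.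
Qed.

Lemma X_fwordV (a : Defs.fpath E) : X (fword a)^-1%g = Xv (frng a).
Proof.
apply/seteqP; split=> xi; last by move=> h; apply: Or42; exists a.
move=> /theta_dom[eta]; rewrite invgK => h.
have : theta (word (fseq a) * (word [::])^-1)%g xi eta by rewrite /= invg1 mulg1.
move=> /(theta_ext (@irred_nilr _ _))[z [[/= ez _ _] [_ _ hz]]].
by rewrite /Xv /= /bsrc ez -hz.
Qed.

(** The factors are [1_(a^-1) delta_(a^-1)] on the left and [1_a delta_a] on the
    right: prepending [a] to a path in [X_v], for [v = r(a)], and cutting it off
    again is the identity of [X_v], which equals [X_(a^-1)]. *)
Lemma conj_word (a : Defs.fpath E) (h : D 1%g (charfun K (X (fword a)))) :
  exists y z, skew_mul (skew_mul y (single h)) z = skew_vertex K (frng a).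
Proof.
have n1 : fword a <> 1%g by exact: word_neq1.
have nV : ((fword a)^-1)%g <> 1%g by move=> e; apply: n1; rewrite -[fword a]invgK e invg1.
exists (single (D_charX nV)), (single (D_charX n1)); apply: val_inj; apply/funext => p.
have c1 : coef_mul (fword a)^-1%g (charfun K (X (fword a)^-1%g))
    (charfun K (X (fword a))) = charfun K (X (fword a)^-1%g).
  by rewrite -{3}[fword a]invgK coef_mul_char //; exact: D_charX.
rewrite -[p in LHS](mulgVK (fword a)) [LHS]skew_mul_singler.
rewrite -[X in skew_mul _ _ X](mulKg (fword a)) skew_mul_singlel /= /delta.
have [->|p1] := eqVneq p 1%g; first by rewrite mul1g mulgV eqxx !c1 X_fwordV.
case: eqP => [e|_]; last by rewrite coef_mul0r coef_mul0l.
case/eqP: p1; apply: (mulIg (fword a)^-1%g); apply: (mulgI (fword a)).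
by rewrite mul1g mulgV.
Qed.

(** * Ideals of the skew group ring *)

Definition two_sided_ideal (I : set (skew_ring E K)) : Prop :=
  [/\ I 0, forall (k : K) x y, I x -> I y -> I (k *: x + y),
      forall x y, I y -> I (skew_mul x y) & forall x y, I x -> I (skew_mul x y)].

(** Multiplying by [1_(p^-1) delta_(p^-1)] on the right moves the coefficient at
    [p] to the neutral element without changing it. *)
Lemma ideal_coef1 (I : set (skew_ring E K)) x : two_sided_ideal I ->
  I x -> x <> 0 -> exists2 y, I y & y 1%g <> 0.
Proof.
move=> [_ _ _ Ir] Ix x0; have [p xp] : exists p, x p <> 0.
  apply: contrapT => n; apply: x0; apply: val_inj; apply/funext => p.
  by apply: contrapT => xp; apply: n; exists p.
have [p1|p1] := pselect (p = 1%g); first by exists x => //; rewrite -p1.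
have pV : (p^-1)%g <> 1%g by move=> e; apply: p1; rewrite -[p]invgK e invg1.
exists (skew_mul x (single (D_charX pV))); first exact: Ir.
by rewrite -(mulgV p) skew_mul_singler coef_mul_char //; exact: skewD.
Qed.

(** After the coefficient at the neutral element has been made nonzero, compress
    by a cylinder on which it is constant and which the other elements of the
    support move off itself: only a scalar multiple of the characteristic
    function of the cylinder survives. *)
Lemma ideal_cyl (I : set (skew_ring E K)) x : condition_L E -> two_sided_ideal I ->
  I x -> x <> 0 -> exists n xi, I (single (D1 (D0_cyl n xi))).
Proof.
move=> cL idI Ix0 x0; have [I0 ID Il Ir] := idI.
have [y Iy y1] := ideal_coef1 idI Ix0 x0.
have [xi yxi] : exists xi, y 1%g xi <> 0.
  apply: contrapT => n; apply: y1; apply/funext => xi.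
  by apply: contrapT => h; apply: n; exists xi.
have /DP[Dy _] := skewD y 1%g.
have [n hn] := D0_locally_constant xi Dy.
have [eta [m [sub sep]]] :=
  separating_cylinder (finmap.enum_fset (fset_set [set p | y p <> 0])) xi n cL.
exists m, eta; set e := single _; set k : K := y 1%g xi.
have ek : skew_mul (skew_mul e y) e = k *: e.
  apply: compress => [zeta /sub/hn //|p yp p1 zeta zeta'].
  by apply: sep => //; rewrite in_fset_set ?mem_set //; exact: skew_fin.
have k0 : k != 0 by exact/eqP.
rewrite -[e]scale1r -(mulVf k0) -scalerA -ek -[_ *: _]addr0.
by apply: ID => //; exact/Ir/Il.
Qed.

(** A cylinder is either the set of all boundary paths from a vertex or
    conjugate to one, so the preceding lemma reaches a vertex. *)
Lemma ideal_vertex (I : set (skew_ring E K)) x : condition_L E -> two_sided_ideal I ->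
  I x -> x <> 0 -> exists v, I (skew_vertex K v).
Proof.
move=> cL idI Ix x0; have [n [xi]] := ideal_cyl cL idI Ix x0.
have [_ _ Il Ir] := idI.
move: (D1 _); have [->|[a ->]] := cyl_basic n xi => h Ih.
  exists (bsrc xi); rewrite (_ : skew_vertex K _ = single h) //; exact: val_inj.
by exists (frng a); have [y [z <-]] := conj_word h; exact/Ir/Il.
Qed.

End SkewRing.

Theorem corollary4p4 (E : digraph) (K : fieldType)
  (B : lmodType K) (mulB : B -> B -> B)
  (mulBA : associative mulB)
  (mulBl : forall b : B, linear (fun a : B => mulB a b))
  (mulBr : forall a : B, linear (fun b : B => mulB a b))
  (phi : {linear skew_ring E K -> B})
  (phiM : forall x y : skew_ring E K, phi (skew_mul x y) = mulB (phi x) (phi y)) :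
  condition_L E ->
  (forall v : vertex E, phi (skew_vertex K v) <> 0) ->
  injective phi.
Proof.
move=> cL phiv.
have l0 b : mulB 0 b = 0.
  by have := mulBl b (-1) 0 0; rewrite scaler0 addr0 scaleN1r addNr.
have r0 b : mulB b 0 = 0.
  by have := mulBr b (-1) 0 0; rewrite scaler0 addr0 scaleN1r addNr.
have ker_ideal : two_sided_ideal (fun x => phi x = 0).
  split=> [|k x y hx hy|x y hy|x y hx]; first exact: raddf0.
  - by rewrite linearP hx hy scaler0 addr0.
  - by rewrite phiM hy r0.
  - by rewrite phiM hx l0.
move=> x y exy; apply: contrapT => nxy.
have xy0 : x - y <> 0 by move/subr0_eq.
have [|v] := ideal_vertex cL ker_ideal _ xy0; last exact: phiv.
by rewrite linearB exy subrr.
Qed.
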